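(* Let $\operatorname{mon}:\mathbb{A}^5(\mathbb{C})\to \mathrm{SL}_2(\mathbb{C})$ be the morphism $$(x_1,\dots,x_5)\mapsto\begin{pmatrix} 0 & -1 \\ 1 & 0 \end{pmatrix}\begin{pmatrix} 1 & 0 \\ x_5 & 1 \end{pmatrix}\begin{pmatrix} 1 & x_4 \\ 0 & 1 \end{pmatrix}\begin{pmatrix} 1 & 0 \\ x_3 & 1 \end{pmatrix}\begin{pmatrix} 1 & x_2 \\ 0 & 1 \end{pmatrix}\begin{pmatrix} 1 & 0 \\ x_1 & 1 \end{pmatrix}.$$ Then $\operatorname{mon}$ is surjective. For $\begin{pmatrix} a & b \\ c & d \end{pmatrix}\in \mathrm{SL}_2(\mathbb{C})$, on the fibre of $\operatorname{mon}$ above this matrix one has $$x_1=-c(x_3+x_5+x_3x_4x_5)-a(1+x_3x_4),\qquad x_2=d(1+x_4x_5)+bx_4,$$ and the projection to the coordinates $(x_3,x_4,x_5)$ identifies the fibre with the affine surface $$d(x_3+x_5+x_3x_4x_5)+b(1+x_3x_4)+1=0.$$ For $d=0$ this equation reads $x_3x_4=-b^{-1}-1$ (with $x_5$ free), and for $d=0$, $b\ne-1$ the fibre is isomorphic to $\mathbb{C}^*\times\mathbb{C}$.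
   Context: The space $\mathbb{A}^5$ is the space of Stokes data at $z=\infty$ for rank 2 connections with regular singularity at $z=0$ and generalized eigenvalues $\pm(z^{5/2}+\frac t2 z^{1/2})$ at $z=\infty$; $\operatorname{mon}$ gives the monodromy at $z=0$. *)

(* Defs.v *)
From HB Require Import structures.
From mathcomp Require Import all_boot all_order all_algebra.
From mathcomp Require Import complex mpoly.
From mathcomp Require Import classical_sets functions reals.

Set Implicit Arguments.
Unset Strict Implicit.
Unset Printing Implicit Defensive.

Import GRing.Theory.
Local Open Scope ring_scope.
Local Open Scope classical_set_scope.

(** Points of affine n-space are row vectors, with coordinates numbered from 0;
    affine varieties are taken in the classical sense, as Zariski closed subsets
    of affine space over an (algebraically closed) field. *)

Definition zariski_closed (K : fieldType) (n : nat) (X : set 'rV[K]_n) : Prop :=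
  exists s : seq {mpoly K[n]},
    X = [set x : 'rV[K]_n | forall p, p \in s -> p.@[x 0] = 0].

(** On a Zariski closed subset of affine space the regular functions are exactly
    the restrictions of polynomials; only the values of [f] on [X] matter. *)
Definition regular_map (K : fieldType) (n m : nat)
    (X : set 'rV[K]_n) (Y : set 'rV[K]_m) (f : 'rV[K]_n -> 'rV[K]_m) : Prop :=
  [/\ zariski_closed X, zariski_closed Y, set_fun X Y f &
      exists p : 'I_m -> {mpoly K[n]},
        forall x, X x -> forall j, f x 0 j = (p j).@[x 0]].

Definition variety_iso (K : fieldType) (n m : nat)
    (X : set 'rV[K]_n) (Y : set 'rV[K]_m) (f : 'rV[K]_n -> 'rV[K]_m) : Prop :=
  regular_map X Y f /\
  exists g : 'rV[K]_m -> 'rV[K]_n,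
    [/\ regular_map Y X g, forall x, X x -> g (f x) = x &
        forall y, Y y -> f (g y) = y].

Definition isomorphic (K : fieldType) (n m : nat)
    (X : set 'rV[K]_n) (Y : set 'rV[K]_m) : Prop :=
  exists f, variety_iso X Y f.

Definition mx2 (K : fieldType) (a b c d : K) : 'M[K]_2 :=
  \matrix_(i, j) if i == 0 then (if j == 0 then a else b)
                 else (if j == 0 then c else d).

Definition SL2 (K : fieldType) : set 'M[K]_2 := [set A | \det A = 1].

Definition mon (K : fieldType) (x : 'rV[K]_5) : 'M[K]_2 :=
  let: (x1, x2, x3, x4, x5) := (x 0 0, x 0 1, x 0 2, x 0 3, x 0 4) in
  mx2 0 (-1) 1 0 *m mx2 1 0 x5 1 *m mx2 1 x4 0 1 *m mx2 1 0 x3 1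
    *m mx2 1 x2 0 1 *m mx2 1 0 x1 1.

Definition fibre (K : fieldType) (A : 'M[K]_2) : set 'rV[K]_5 :=
  @mon K @^-1` [set A].

Definition proj345 (K : fieldType) (x : 'rV[K]_5) : 'rV[K]_3 :=
  \row_j [:: x 0 2; x 0 3; x 0 4]`_j.

(** Affine 3-space here has coordinates (x3, x4, x5). *)
Definition surface (K : fieldType) (b d : K) : set 'rV[K]_3 :=
  [set y : 'rV[K]_3 | let: (x3, x4, x5) := (y 0 0, y 0 1, y 0 2) in
     d * (x3 + x5 + x3 * x4 * x5) + b * (1 + x3 * x4) + 1 = 0].

(** The affine variety [K^* x K], with [K^*] embedded in the plane as the
    hyperbola [u v = 1] (so that its regular functions are the Laurent
    polynomials in [u]). *)
Definition Gm_x_A1 (K : fieldType) : set 'rV[K]_3 :=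
  [set y : 'rV[K]_3 | y 0 0 * y 0 1 = 1].

(* Main.v *)
Require Import Defs.
From HB Require Import structures.
From mathcomp Require Import all_boot all_order all_algebra.
From mathcomp Require Import complex mpoly.
From mathcomp Require Import classical_sets functions reals.
From mathcomp Require Import ring.

Set Implicit Arguments.
Unset Strict Implicit.
Unset Printing Implicit Defensive.

Import GRing.Theory.
Local Open Scope ring_scope.
Local Open Scope classical_set_scope.

(** Put [T = x3 + x5 + x3 x4 x5], [P = 1 + x3 x4], [V = 1 + x4 x5].  The first
    four factors of [mon x] have product [[-T, -V], [P, x4]], of determinant 1,
    so [mon x = [[a, b], [c, d]]] amounts to [b = - T x2 - V], [d = P x2 + x4],
    [a = - T + b x1], [c = P + d x1].  Eliminating with [P V - x4 T = 1] gives
    [d T + b P = -1] and the formulas for [x1] and [x2]; conversely those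
    formulas define a polynomial section over the surface [d T + b P = -1].
    This surface is never empty, and for [d = 0] and [b <> -1] it is the product
    of the hyperbola [x3 x4 = - 1/b - 1] with a line. *)

(** * Polynomial functions, closed sets and regular maps *)

Definition polynomial_fun (K : fieldType) (n : nat) (f : 'rV[K]_n -> K) : Prop :=
  exists p : {mpoly K[n]}, forall x, f x = p.@[x 0].

Section PolynomialFunctions.
Context {K : fieldType} {n : nat}.
Implicit Types f g : 'rV[K]_n -> K.

Lemma polynomial_fun_cst (c : K) :
  polynomial_fun (fun _ : 'rV[K]_n => c).
Proof. by exists c%:MP => x; rewrite mevalC. Qed.

Lemma polynomial_fun_coord (i : 'I_n) :
  polynomial_fun (fun x : 'rV[K]_n => x 0 i).
Proof. by exists 'X_i => x; rewrite mevalXU. Qed.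

Lemma polynomial_funD f g : polynomial_fun f -> polynomial_fun g ->
  polynomial_fun (fun x => f x + g x).
Proof. by move=> [p fp] [q gq]; exists (p + q) => x; rewrite mevalD fp gq. Qed.

Lemma polynomial_funM f g : polynomial_fun f -> polynomial_fun g ->
  polynomial_fun (fun x => f x * g x).
Proof. by move=> [p fp] [q gq]; exists (p * q) => x; rewrite mevalM fp gq. Qed.

Lemma polynomial_funN f : polynomial_fun f -> polynomial_fun (fun x => - f x).
Proof. by move=> [p fp]; exists (- p) => x; rewrite mevalN fp. Qed.

Lemma polynomial_fun_sum (I : Type) (r : seq I) (F : I -> 'rV[K]_n -> K) :
  (forall i, polynomial_fun (F i)) ->
  polynomial_fun (fun x => \sum_(i <- r) F i x).
Proof.
move=> Fp; elim: r => [|i r IHr].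
  by exists 0 => x; rewrite big_nil meval0.
have [p pE] := polynomial_funD (Fp i) IHr.
by exists p => x; rewrite big_cons pE.
Qed.

Lemma polynomial_fun_mulmx (l m q : nat)
    (A : 'rV[K]_n -> 'M[K]_(l, m)) (B : 'rV[K]_n -> 'M[K]_(m, q)) :
  (forall i j, polynomial_fun (fun x => A x i j)) ->
  (forall i j, polynomial_fun (fun x => B x i j)) ->
  forall i j, polynomial_fun (fun x => (A x *m B x) i j).
Proof.
move=> Ap Bp i j.
have [k|p pE] := @polynomial_fun_sum _ (index_enum 'I_m)
  (fun k x => A x i k * B x k j); first exact: polynomial_funM.
by exists p => x; rewrite mxE pE.
Qed.

Lemma polynomial_fun_mx2 (a b c d : 'rV[K]_n -> K) :
  polynomial_fun a -> polynomial_fun b -> polynomial_fun c ->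
  polynomial_fun d ->
  forall i j, polynomial_fun (fun x => mx2 (a x) (b x) (c x) (d x) i j).
Proof.
move=> [pa aE] [pb bE] [pc cE] [pd dE] i j.
exists (if i == 0 then (if j == 0 then pa else pb)
        else if j == 0 then pc else pd) => x.
by rewrite mxE; case: ifP => _; case: ifP.
Qed.

(** Choosing one polynomial per index of the finite type [I] yields the finite list required by
    [zariski_closed]. *)
Lemma zariski_closed_zeros (I : finType) (F : I -> 'rV[K]_n -> K) :
  (forall i, polynomial_fun (F i)) ->
  zariski_closed [set x | forall i, F i x = 0].
Proof.
move=> /fin_all_exists [p pE]; exists [seq p i | i : I].
apply/seteqP; split=> x /= Hx.
  by move=> q /mapP[i _ ->]; rewrite -pE.
by move=> i; rewrite pE; apply: Hx; apply: map_f; rewrite mem_enum.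
Qed.

Lemma zariski_closed_zero f :
  polynomial_fun f -> zariski_closed [set x | f x = 0].
Proof.
move=> fp; have := @zariski_closed_zeros unit (fun _ => f) (fun _ => fp).
by congr zariski_closed; apply/seteqP; split=> x /= // /(_ tt).
Qed.

Lemma zariski_closedT : zariski_closed [set: 'rV[K]_n].
Proof. by exists [::]; apply/seteqP; split. Qed.

Lemma regular_map_polynomial (m : nat) (X : set 'rV[K]_n) (Y : set 'rV[K]_m)
    (f : 'rV[K]_n -> 'rV[K]_m) :
  zariski_closed X -> zariski_closed Y -> set_fun X Y f ->
  (forall j, polynomial_fun (fun x => f x 0 j)) -> regular_map X Y f.
Proof.
move=> Xc Yc fXY /fin_all_exists [p pE].
by split=> //; exists p => x _ j; exact: pE.
Qed.

(** Rows below are literal lists of expressions in [x]. Reading such a list as a list of functions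
    evaluated at [x] lets each entry be checked separately. *)
Lemma polynomial_fun_row (m : nat) (s : seq ('rV[K]_n -> K)) (j : 'I_m) :
  (forall i, (i < size s)%N -> polynomial_fun (nth (fun=> 0) s i)) ->
  polynomial_fun (fun x => (\row_(i < m) [seq f x | f <- s]`_i) 0 j).
Proof.
move=> sp; have [js|sj] := ltnP j (size s).
  have [p pE] := sp _ js; exists p => x.
  by rewrite mxE (nth_map (fun=> 0)).
(* Past the end of [s] the entry is the default value 0, a constant polynomial. *)
by exists 0 => x; rewrite mxE nth_default ?size_map // meval0.
Qed.

End PolynomialFunctions.

Ltac polynomial_fun_tac :=
  repeat first [ exact: polynomial_fun_coord | exact: polynomial_fun_cst
               | apply: polynomial_funD | apply: polynomial_funN
               | apply: polynomial_funM ].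

(** * Composition of regular maps and of isomorphisms *)

Lemma regular_map_comp (K : fieldType) (n m l : nat) (X : set 'rV[K]_n)
    (Y : set 'rV[K]_m) (Z : set 'rV[K]_l) f g :
  regular_map X Y f -> regular_map Y Z g -> regular_map X Z (g \o f).
Proof.
move=> [Xc _ fXY [p pE]] [_ Zc gYZ [q qE]]; split=> //.
  by move=> x /fXY /gYZ.
(* The polynomials of [f] are substituted into those of [g]; the latter represent [g] at [f x]
   because [f] maps [X] into [Y]. *)
exists (fun j => q j \mPo [tuple p i | i < m]) => x Xx j /=.
rewrite (qE _ (fXY _ Xx)) comp_mpoly_meval; apply: meval_eq => i.
by rewrite tnth_mktuple pE.
Qed.

Lemma isomorphic_trans (K : fieldType) (n m l : nat) (X : set 'rV[K]_n)
    (Y : set 'rV[K]_m) (Z : set 'rV[K]_l) :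
  isomorphic X Y -> isomorphic Y Z -> isomorphic X Z.
Proof.
move=> [f [fXY [f' [fYX fK f'K]]]] [g [gYZ [g' [gZY gK g'K]]]].
have [_ _ fX _] := fXY; have [_ _ g'Y _] := gZY.
exists (g \o f); split; first exact: regular_map_comp fXY gYZ.
exists (f' \o g'); split; first exact: regular_map_comp gZY fYX.
- by move=> x Xx /=; rewrite gK ?fK //; exact: fX.
- by move=> z Zz /=; rewrite f'K ?g'K //; exact: g'Y.
Qed.

(** * Two-by-two matrices and the entries of [mon] *)

Section Monodromy.
Context {K : fieldType}.
Implicit Types (a b c d : K) (x : 'rV[K]_5) (y : 'rV[K]_3).

Lemma det_mx22 (A : 'M[K]_2) : \det A = A 0 0 * A 1 1 - A 0 1 * A 1 0.
Proof.
rewrite (expand_det_row _ 0) big_ord_recl big_ord1 /cofactor !det_mx11 !mxE /=.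
rewrite expr0 expr1 mul1r mulN1r mulrN.
by congr (A _ _ * A _ _ - A _ _ * A _ _); apply/val_inj.
Qed.

Lemma mx2_mul a b c d a' b' c' d' :
  mx2 a b c d *m mx2 a' b' c' d' =
  mx2 (a * a' + b * c') (a * b' + b * d') (c * a' + d * c') (c * b' + d * d').
Proof.
apply/matrixP => i j; rewrite !mxE big_ord_recl big_ord1 !mxE /=.
by case: (i == 0); case: (j == 0).
Qed.

Lemma mx2_inj a b c d a' b' c' d' :
  mx2 a b c d = mx2 a' b' c' d' -> [/\ a = a', b = b', c = c' & d = d'].
Proof.
by move=> /matrixP E; split;
   [have := E 0 0|have := E 0 1|have := E 1 0|have := E 1 1]; rewrite !mxE.
Qed.

Lemma mx2_eta (A : 'M[K]_2) : A = mx2 (A 0 0) (A 0 1) (A 1 0) (A 1 1).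
Proof.
apply/matrixP => i j; rewrite !mxE.
by case: i => [[|[|//]] ?]; case: j => [[|[|//]] ?];
   congr (A _ _); apply/val_inj.
Qed.

Lemma det_mx2 a b c d : \det (mx2 a b c d) = a * d - b * c.
Proof. by rewrite det_mx22 !mxE. Qed.

Lemma det_mon x : \det (mon x) = 1.
Proof. by rewrite /mon !det_mulmx !det_mx2; ring. Qed.

(** The last factor adds [x1] times the second column to the first, so the left entries reuse [b]
    and [d]. *)
Lemma monE x : let: (x1, x2, x3, x4, x5) :=
    (x 0 0, x 0 1, x 0 2, x 0 3, x 0 4) in
  let T := x3 + x5 + x3 * x4 * x5 in
  let b := - T * x2 - (1 + x4 * x5) in
  let d := (1 + x3 * x4) * x2 + x4 in
  mon x = mx2 (- T + b * x1) b (1 + x3 * x4 + d * x1) d.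
Proof. by rewrite /mon !mx2_mul /=; congr mx2; ring. Qed.

Lemma polynomial_fun_mon (i j : 'I_2) : polynomial_fun (fun x => mon x i j).
Proof.
move: i j; rewrite /mon.
(* Each round splits off the rightmost factor, until only the constant first matrix is left. *)
do 5! [apply: polynomial_fun_mulmx; last by apply: polynomial_fun_mx2;
  polynomial_fun_tac].
by apply: polynomial_fun_mx2; polynomial_fun_tac.
Qed.

(** * Coordinates on a fibre and the section over the surface *)

Lemma fibre_coords a b c d x : fibre (mx2 a b c d) x ->
  let: (x1, x2, x3, x4, x5) := (x 0 0, x 0 1, x 0 2, x 0 3, x 0 4) in
  x1 = - c * (x3 + x5 + x3 * x4 * x5) - a * (1 + x3 * x4) /\
  x2 = d * (1 + x4 * x5) + b * x4.
Proof.
(* After substitution of the entries, [d T + b P = x4 T - P V = -1] reduces [- c T - a P] to [x1],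
   and [d V + b x4] becomes [(P V - x4 T) x2 = x2]. *)
by rewrite /fibre /= monE => /mx2_inj[<- <- <- <-]; split; ring.
Qed.

(** The inverse of [proj345] over the surface: its first two entries are the values forced by
    [fibre_coords]. *)
Definition section345 a b c d y : 'rV[K]_5 :=
  let: (x3, x4, x5) := (y 0 0, y 0 1, y 0 2) in
  \row_j [:: - c * (x3 + x5 + x3 * x4 * x5) - a * (1 + x3 * x4);
             d * (1 + x4 * x5) + b * x4; x3; x4; x5]`_j.

Lemma proj345_surface a b c d x :
  fibre (mx2 a b c d) x -> surface b d (proj345 x).
Proof.
by rewrite /fibre /surface /= monE !mxE /= => /mx2_inj[_ <- _ <-]; ring.
Qed.

Lemma section345_fibre a b c d y : SL2 (mx2 a b c d) -> surface b d y ->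
  fibre (mx2 a b c d) (section345 a b c d y).
Proof.
rewrite /SL2 /surface /fibre /= det_mx2 monE !mxE /=.
move: (y 0 0) (y 0 1) (y 0 2) => x3 x4 x5 adbc E.
set T := x3 + x5 + x3 * x4 * x5 in E *.
set P := 1 + x3 * x4 in E *; set V := 1 + x4 * x5.
have PV : P * V = x4 * T + 1 by rewrite /P /V /T; ring.
have bP : b * P = - 1 - d * T by rewrite -[LHS]subr0 -E; ring.
have ad : b * c + 1 = a * d by rewrite -adbc; ring.
(* From here on [T], [P] and [V] are treated as indeterminates subject to [PV] and [bP]. *)
clearbody T P V.
(* The right column comes first, since the left entries in [monE] contain it. *)
have -> : - T * (d * V + b * x4) - V = b.
  transitivity ((- 1 - d * T) * V - b * (x4 * T)); first by ring.
  by rewrite -bP -mulrA PV; ring.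
have -> : P * (d * V + b * x4) + x4 = d.
  transitivity (d * (P * V) + b * P * x4 + x4); first by ring.
  by rewrite PV bP; ring.
(* The left column remains; here the determinant condition enters, as [b * c + 1 = a * d]. *)
congr mx2.
  transitivity (- (b * c + 1) * T - a * (b * P)); first by ring.
  by rewrite ad bP; ring.
transitivity (P - c * (d * T) - a * d * P); first by ring.
rewrite -ad; transitivity (- c * (d * T) - c * (b * P)); first by ring.
by rewrite bP; ring.
Qed.

Lemma section345K a b c d y : proj345 (section345 a b c d y) = y.
Proof.
apply/rowP => -[[|[|[|//]]] ?]; rewrite !mxE /=; congr (y _ _); exact/val_inj.
Qed.

Lemma proj345K a b c d x : fibre (mx2 a b c d) x ->
  section345 a b c d (proj345 x) = x.
Proof.
move=> /fibre_coords [x1E x2E].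
apply/rowP => -[[|[|[|[|[|//]]]]] ?]; rewrite !mxE /= -?x1E -?x2E;
  congr (x _ _); exact/val_inj.
Qed.

(** * The projection as an isomorphism of affine varieties *)

Lemma zariski_closed_fibre (A : 'M[K]_2) : zariski_closed (fibre A).
Proof.
(* The matrix equation is split into four scalar equations, indexed by pairs of indices. *)
have -> : fibre A =
    [set x | forall ij : 'I_2 * 'I_2, mon x ij.1 ij.2 - A ij.1 ij.2 = 0].
  apply/seteqP; split=> x /=; first by move=> -> ij; rewrite subrr.
  move=> E; apply/matrixP => i j; apply/eqP; rewrite -subr_eq0; apply/eqP.
  exact: E (i, j).
apply: zariski_closed_zeros => ij; apply: polynomial_funD.
  exact: polynomial_fun_mon.
exact: polynomial_fun_cst.
Qed.

Lemma zariski_closed_surface b d : zariski_closed (@surface K b d).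
Proof. by apply: zariski_closed_zero; polynomial_fun_tac. Qed.

Lemma variety_iso_proj345 a b c d : SL2 (mx2 a b c d) ->
  variety_iso (fibre (mx2 a b c d)) (surface b d) (@proj345 K).
Proof.
move=> A1; split.
  apply: regular_map_polynomial.
  - exact: zariski_closed_fibre.
  - exact: zariski_closed_surface.
  - by move=> x; exact: proj345_surface.
  - move=> j; apply: (@polynomial_fun_row _ _ _
      [:: fun x => x 0 2; fun x => x 0 3; fun x => x 0 4]).
    by case=> [|[|[|//]]] _; polynomial_fun_tac.
exists (section345 a b c d); split.
- apply: regular_map_polynomial.
  + exact: zariski_closed_surface.
  + exact: zariski_closed_fibre.
  + by move=> y; exact: section345_fibre.
  + move=> j; apply: (@polynomial_fun_row _ _ _
      [:: fun y => - c * (y 0 0 + y 0 2 + y 0 0 * y 0 1 * y 0 2)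
                   - a * (1 + y 0 0 * y 0 1);
          fun y => d * (1 + y 0 1 * y 0 2) + b * y 0 1;
          fun y => y 0 0; fun y => y 0 1; fun y => y 0 2]).
    by case=> [|[|[|[|[|//]]]]] _; polynomial_fun_tac.
- by move=> x; exact: proj345K.
- by move=> y _; exact: section345K.
Qed.

(** * Points of the surface, surjectivity and regularity of [mon] *)

Lemma SL2_d0_b_neq0 a b c : SL2 (mx2 a b c 0) -> b != 0.
Proof.
rewrite /SL2 /= det_mx2 mulr0 sub0r => bc; apply/eqP => b0.
by move/eqP: bc; rewrite b0 mul0r oppr0 eq_sym oner_eq0.
Qed.

Lemma surface_d0 b : b != 0 ->
  surface b 0 = [set y : 'rV[K]_3 |
    let: (x3, x4) := (y 0 0, y 0 1) in x3 * x4 = - b^-1 - 1].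
Proof.
move=> b0; apply/seteqP; split=> y; rewrite /surface /= => E.
  (* After multiplication by [b], the difference of the two sides is the left side of the surface
     equation. *)
  apply: (mulfI b0); apply/eqP; rewrite -subr_eq0 -[X in _ == X]E; apply/eqP.
  by field.
by rewrite E; field.
Qed.

Lemma surface_nonempty a b c d : SL2 (mx2 a b c d) ->
  exists y, @surface K b d y.
Proof.
have [->|d0] := eqVneq d 0 => [/SL2_d0_b_neq0 b0|_].
  (* The choice [x4 = 1] solves [x3 * x4 = - b^-1 - 1]. *)
  by exists (\row_j [:: - b^-1 - 1; 1; 0]`_j); rewrite surface_d0 //= !mxE mulr1.
(* At [x3 = x4 = 0] the equation becomes [d * x5 + b + 1 = 0], which is solved for [x5]. *)
exists (\row_j [:: 0; 0; - (b + 1) / d]`_j).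
by rewrite /surface /= !mxE /=; field.
Qed.

(** The section carries a point of the surface to a preimage of the matrix, so nonemptiness of the
    surface suffices. *)
Lemma mon_surj : set_surj [set: 'rV[K]_5] (@SL2 K) (@mon K).
Proof.
move=> A; rewrite [A]mx2_eta => A1; have [y yS] := surface_nonempty A1.
by eexists; last exact: section345_fibre A1 yS.
Qed.

Lemma regular_map_mon :
  regular_map [set: 'rV[K]_5] (mxvec @` @SL2 K) (fun x => mxvec (mon x)).
Proof.
apply: regular_map_polynomial.
- exact: zariski_closedT.
(* Flattening by [mxvec] places [SL2] in affine 4-space as the hypersurface where the determinant
   minus 1 vanishes. *)
- have -> : mxvec @` @SL2 K =
    [set v | vec_mx v 0 0 * vec_mx v 1 1 - vec_mx v 0 1 * vec_mx v 1 0 - 1 = 0].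
    apply/seteqP; split=> [_ [A A1 <-]|v] /=.
      by rewrite mxvecK -det_mx22 A1 subrr.
    rewrite -det_mx22 => /subr0_eq v1.
    by exists (vec_mx v); rewrite ?vec_mxK.
  have vp i j : polynomial_fun (fun v : 'rV[K]_(2 * 2) => vec_mx v i j).
    by exists 'X_(mxvec_index i j) => v; rewrite mxE mevalXU.
  apply: zariski_closed_zero.
  apply: polynomial_funD; last exact: polynomial_fun_cst.
  by apply: polynomial_funD; last apply: polynomial_funN; apply: polynomial_funM.
- by move=> x _; exists (mon x) => //; exact: det_mon.
- case/mxvec_indexP=> i j; have [p pE] := polynomial_fun_mon i j.
  by exists p => x; rewrite mxvecE.
Qed.

(** * The surface for [d = 0] as a hyperbola times a line *)

Lemma zariski_closed_Gm_x_A1 : zariski_closed (@Gm_x_A1 K).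
Proof.
have -> : @Gm_x_A1 K = [set y | y 0 0 * y 0 1 - 1 = 0].
  apply/seteqP; split=> y; rewrite /Gm_x_A1 /=; last exact: subr0_eq.
  by move=> ->; rewrite subrr.
by apply: zariski_closed_zero; polynomial_fun_tac.
Qed.

(** Scaling [x4] by [k^-1] turns [x3 * x4 = k] into the hyperbola [u v = 1], while [x5] parametrizes
    the line. *)
Lemma isomorphic_surface_d0 b : b != 0 -> b != -1 ->
  isomorphic (surface b 0) (@Gm_x_A1 K).
Proof.
move=> b0 b1; pose k := - b^-1 - 1.
have k0 : k != 0.
  (* If [k = 0] then [- b^-1 = 1], hence [b = -1]. *)
  apply: contraNneq b1 => /subr0_eq /(congr1 -%R); rewrite opprK.
  by move=> /(congr1 (@GRing.inv K)); rewrite invrK invrN1 => ->.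
exists (fun y => \row_j [:: y 0 0; k^-1 * y 0 1; y 0 2]`_j); split.
  apply: regular_map_polynomial.
  - exact: zariski_closed_surface.
  - exact: zariski_closed_Gm_x_A1.
  - move=> y; rewrite surface_d0 // /Gm_x_A1 /= !mxE /= mulrCA => ->.
    exact: mulVf.
  - move=> j; apply: (@polynomial_fun_row _ _ _
      [:: fun y => y 0 0; fun y => k^-1 * y 0 1; fun y => y 0 2]).
    by case=> [|[|[|//]]] _; polynomial_fun_tac.
exists (fun y => \row_j [:: y 0 0; k * y 0 1; y 0 2]`_j); split.
- apply: regular_map_polynomial.
  + exact: zariski_closed_Gm_x_A1.
  + exact: zariski_closed_surface.
  + move=> y; rewrite surface_d0 // /Gm_x_A1 /= !mxE /= mulrCA => ->.
    by rewrite mulr1.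
  + move=> j; apply: (@polynomial_fun_row _ _ _
      [:: fun y => y 0 0; fun y => k * y 0 1; fun y => y 0 2]).
    by case=> [|[|[|//]]] _; polynomial_fun_tac.
- move=> y _; apply/rowP => -[[|[|[|//]]] ?];
    rewrite !mxE /= ?mulVKf //; congr (y _ _); exact/val_inj.
- move=> y _; apply/rowP => -[[|[|[|//]]] ?];
    rewrite !mxE /= ?mulKf //; congr (y _ _); exact/val_inj.
Qed.

End Monodromy.

Theorem mainTheorem6 (R : realType) :
  [/\ regular_map [set: 'rV[R[i]]_5] (mxvec @` @SL2 R[i])
        (fun x => mxvec (mon x)),
      set_surj [set: 'rV[R[i]]_5] (@SL2 R[i]) (@mon R[i]) &
      forall a b c d : R[i], SL2 (mx2 a b c d) ->
        [/\ forall x : 'rV[R[i]]_5, fibre (mx2 a b c d) x ->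
              let: (x1, x2, x3, x4, x5) :=
                (x 0 0, x 0 1, x 0 2, x 0 3, x 0 4) in
              x1 = - c * (x3 + x5 + x3 * x4 * x5) - a * (1 + x3 * x4) /\
              x2 = d * (1 + x4 * x5) + b * x4,
            variety_iso (fibre (mx2 a b c d)) (surface b d) (@proj345 R[i]),
            d = 0 -> b != 0 /\
              surface b d = [set y : 'rV[R[i]]_3 |
                let: (x3, x4) := (y 0 0, y 0 1) in x3 * x4 = - b^-1 - 1] &
            d = 0 -> b != -1 ->
              isomorphic (fibre (mx2 a b c d)) (@Gm_x_A1 R[i])]].
Proof.
split; [exact: regular_map_mon | exact: mon_surj | move=> a b c d A1].
have isoS := variety_iso_proj345 A1.
split=> [x||d0|d0 b1].
- exact: fibre_coords.
- exact: isoS.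
- rewrite d0 in A1 *; have b0 := SL2_d0_b_neq0 A1.
  by split=> //; exact: surface_d0.
- apply: isomorphic_trans; first by exists (@proj345 R[i]); exact: isoS.
  rewrite d0 in A1 *; have b0 := SL2_d0_b_neq0 A1.
  exact: isomorphic_surface_d0.
Qed.
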